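(* Let $\Delta\vdash t$ be a closed nominal term-in-context and $\sigma$ a nominal substitution satisfying $\Delta$ with domain contained in the variables of $t$ and $t\sigma$ ground. Let $\pi_i\cdot X$ and $\pi_j\cdot X$ be two occurrences of the same variable $X$ in $t$, and let $[X\mapsto\underline{\lambda}(\overline{xs}_i).s_i]$ and $[X\mapsto\underline{\lambda}(\overline{xs}_j).s_j]$ be the substitutes obtained by the substitution translation using $\pi_i$, respectively $\pi_j$, in place of the permutation of the leftmost occurrence. Then $\underline{\lambda}(\overline{xs}_i).s_i$ and $\underline{\lambda}(\overline{xs}_j).s_j$ are $\alpha$-equivalent.
   Context: Nominal terms: $s,t ::= a \mid \pi\cdot X \mid [a]s \mid f\,s \mid (s_1,\ldots,s_n)$ over atoms, variables, function symbols and finite-support permutations $\pi$ of atoms acting on terms in the usual nominal way. A freshness context $\Delta$ is a set of constraints $a\#X$; $\sigma$ satisfies $\Delta$ if $\vdash a\#X\sigma$ for all $a\#X\in\Delta$ (standard nominal freshness). Substitutions map variables to terms, applied without avoiding capture. $\Delta\vdash t$ is closed if: (1) every atom occurrence $a$ in $t$ lies under an abstraction $[a]$; (2) if $\pi\cdot X$ is in the scope of an abstraction of $\pi(a)$ then every occurrence $\pi'\cdot X$ of $X$ in $t$ is in the scope of an abstraction of $\pi'(a)$, or $a\#X\in\Delta$; (3) for two occurrences $\pi_1\cdot X,\pi_2\cdot X$ and $a$ with $\pi_1(a)\neq\pi_2(a)$, if $a$ is not abstracted in one of the occurrences then $a\#X\in\Delta$. Translation: $\Lambda_t(X)$ is the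 set of atoms $a$ such that some occurrence of $X$ in $t$ is in the scope of $[a]$. Fix a total order on atoms. $\mathcal{T}(\Delta,u)$ maps a nominal term $u$ to a CRS meta-term by keeping atoms, abstractions, function applications and tuples and replacing each $\pi\cdot Y$ by $Y(\pi\cdot ys)$ with $ys$ the ascending list of $\{\pi^{-1}(a)\mid a\in\Lambda_u(Y)\}\setminus\{a\mid a\#Y\in\Delta\}$. For a permutation $\rho$ of an occurrence $\rho\cdot X$ of $X$ in $t$, the substitute translating $\sigma(X)$ with respect to $\rho$ is $\underline{\lambda}(\rho\cdot xs).\mathcal{T}(\Delta,\rho\cdot\sigma(X))$, where $xs$ is the ascending list of $\{\rho^{-1}(a)\mid a\in\Lambda_t(X)\}\setminus\{a\mid a\#X\in\Delta\}$ and $\rho$ is applied elementwise. A CRS substitute $\underline{\lambda}(a_1,\dots,a_n).s$ binds $a_1,\dots,a_n$ in $s$; $\alpha$-equivalence means equality up to renaming of these and other bound variables. *)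

(* Defs.v *)
(* MathComp (boot) world: atoms, variables and function symbols are nat;
   the fixed total order on atoms is the usual order <= on nat. *)
From mathcomp Require Import all_boot.
Set Implicit Arguments. Unset Strict Implicit. Unset Printing Implicit Defensive.

(* A finite-support permutation of atoms is represented by a list of swaps;
   every finite-support permutation arises this way.  The list is applied
   right-to-left, so [perm_atom (p ++ q) = perm_atom p \o perm_atom q]. *)
Definition perm := seq (nat * nat).

Definition swap_atom (s : nat * nat) (c : nat) : nat :=
  if c == s.1 then s.2 else if c == s.2 then s.1 else c.

Fixpoint perm_atom (p : perm) (c : nat) : nat :=
  match p with
  | [::] => c
  | s :: p' => swap_atom s (perm_atom p' c)
  end.

Definition perm_inv (p : perm) : perm := rev p.

Inductive nterm : Type :=
| NAtom : nat -> nterm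
| NSusp : perm -> nat -> nterm
| NAbs  : nat -> nterm -> nterm
| NApp  : nat -> nterm -> nterm
| NTup  : seq nterm -> nterm.

Fixpoint nact (p : perm) (t : nterm) : nterm :=
  match t with
  | NAtom a => NAtom (perm_atom p a)
  | NSusp q X => NSusp (p ++ q) X
  | NAbs a s => NAbs (perm_atom p a) (nact p s)
  | NApp f s => NApp f (nact p s)
  | NTup ts => NTup (map (nact p) ts)
  end.

(* nominal substitution: [sigma X = None] means X is not in the domain *)
Definition nsubst := nat -> option nterm.

Definition sigma_at (sigma : nsubst) (X : nat) : nterm :=
  match sigma X with Some s => s | None => NSusp [::] X end.

(* application of a substitution (no capture avoidance) *)
Fixpoint napply (sigma : nsubst) (t : nterm) : nterm :=
  match t with
  | NAtom a => NAtom a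
  | NSusp p X => nact p (sigma_at sigma X)
  | NAbs a s => NAbs a (napply sigma s)
  | NApp f s => NApp f (napply sigma s)
  | NTup ts => NTup (map (napply sigma) ts)
  end.

(* freshness contexts: (a, X) stands for a # X *)
Definition fctx := seq (nat * nat).

Fixpoint fresh (D : fctx) (a : nat) (t : nterm) : Prop :=
  match t with
  | NAtom b => a <> b
  | NSusp p X => (perm_atom (perm_inv p) a, X) \in D
  | NAbs b s => a = b \/ fresh D a s
  | NApp _ s => fresh D a s
  | NTup ts => (fix go (l : seq nterm) : Prop :=
                 match l with [::] => True | u :: l' => fresh D a u /\ go l' end) ts
  end.

Definition satisfies (D : fctx) (sigma : nsubst) : Prop :=
  forall a X, (a, X) \in D -> fresh [::] a (napply sigma (NSusp [::] X)).

Fixpoint ground (t : nterm) : Prop :=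
  match t with
  | NAtom _ => True
  | NSusp _ _ => False
  | NAbs _ s | NApp _ s => ground s
  | NTup ts => (fix go (l : seq nterm) : Prop :=
                 match l with [::] => True | u :: l' => ground u /\ go l' end) ts
  end.

Fixpoint vars (t : nterm) : seq nat :=
  match t with
  | NAtom _ => [::]
  | NSusp _ X => [:: X]
  | NAbs _ s | NApp _ s => vars s
  | NTup ts => flatten (map vars ts)
  end.

(* Occurrences of variables: (pi, X, bs) means an occurrence pi . X lying in
   the scope of abstractions of exactly the atoms in bs. *)
Fixpoint occs_aux (bs : seq nat) (t : nterm) : seq (perm * nat * seq nat) :=
  match t with
  | NAtom _ => [::]
  | NSusp p X => [:: (p, X, bs)]
  | NAbs a s => occs_aux (a :: bs) s
  | NApp _ s => occs_aux bs s
  | NTup ts => flatten (map (occs_aux bs) ts)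
  end.

Definition occs (t : nterm) := occs_aux [::] t.

Fixpoint atoms_bound (bs : seq nat) (t : nterm) : Prop :=
  match t with
  | NAtom a => a \in bs
  | NSusp _ _ => True
  | NAbs a s => atoms_bound (a :: bs) s
  | NApp _ s => atoms_bound bs s
  | NTup ts => (fix go (l : seq nterm) : Prop :=
                 match l with [::] => True | u :: l' => atoms_bound bs u /\ go l' end) ts
  end.

Definition nom_closed (D : fctx) (t : nterm) : Prop :=
  (* (1) *)
  atoms_bound [::] t /\
  (* (2) *)
  (forall p X bs a, (p, X, bs) \in occs t -> perm_atom p a \in bs ->
     (forall p' bs', (p', X, bs') \in occs t -> perm_atom p' a \in bs')
     \/ (a, X) \in D) /\
  (* (3) *)
  (forall p1 bs1 p2 bs2 X a,
     (p1, X, bs1) \in occs t -> (p2, X, bs2) \in occs t ->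
     perm_atom p1 a <> perm_atom p2 a ->
     (perm_atom p1 a \notin bs1 \/ perm_atom p2 a \notin bs2) ->
     (a, X) \in D).

Definition Lam (t : nterm) (X : nat) : seq nat :=
  flatten [seq o.2 | o <- occs t & o.1.2 == X].

Definition asc_args (D : fctx) (t : nterm) (X : nat) (rho : perm) : seq nat :=
  sort leq (undup [seq b <- map (perm_atom (perm_inv rho)) (Lam t X)
                   | (b, X) \notin D]).

Inductive mterm : Type :=
| MAtom : nat -> mterm
| MAbs  : nat -> mterm -> mterm
| MApp  : nat -> mterm -> mterm
| MTup  : seq mterm -> mterm
| MMeta : nat -> seq nat -> mterm.

(* T(D, u); [whole] is u, used for Lambda_u *)
Fixpoint trans_aux (D : fctx) (whole : nterm) (t : nterm) : mterm :=
  match t with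
  | NAtom a => MAtom a
  | NSusp p Y => MMeta Y (map (perm_atom p) (asc_args D whole Y p))
  | NAbs a s => MAbs a (trans_aux D whole s)
  | NApp f s => MApp f (trans_aux D whole s)
  | NTup ts => MTup (map (trans_aux D whole) ts)
  end.

Definition trans (D : fctx) (u : nterm) : mterm := trans_aux D u u.

(* CRS substitute  lambda(a1,...,an). s  *)
Definition substitute := (seq nat * mterm)%type.

Definition subst_transl (D : fctx) (t : nterm) (sigma : nsubst) (X : nat)
    (rho : perm) : substitute :=
  (map (perm_atom rho) (asc_args D t X rho), trans D (nact rho (sigma_at sigma X))).

(* bound atoms are compared by the position of their (innermost) binder *)
Definition atom_rel (l1 l2 : seq nat) (a b : nat) : bool :=
  if (a \in l1) || (b \in l2) then (a \in l1) && (b \in l2) && (index a l1 == index b l2)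
  else a == b.

Fixpoint aeq (l1 l2 : seq nat) (m n : mterm) : Prop :=
  match m, n with
  | MAtom a, MAtom b => atom_rel l1 l2 a b
  | MAbs a m', MAbs b n' => aeq (a :: l1) (b :: l2) m' n'
  | MApp f m', MApp g n' => f = g /\ aeq l1 l2 m' n'
  | MTup ms, MTup ns =>
      (fix go (xs ys : seq mterm) : Prop :=
         match xs, ys with
         | [::], [::] => True
         | x :: xs', y :: ys' => aeq l1 l2 x y /\ go xs' ys'
         | _, _ => False
         end) ms ns
  | MMeta Z as_, MMeta Z' bs =>
      Z = Z' /\ size as_ = size bs /\
      (forall i, i < size as_ -> atom_rel l1 l2 (nth 0 as_ i) (nth 0 bs i))
  | _, _ => False
  end.

Definition subst_aeq (s1 s2 : substitute) : Prop :=
  size s1.1 = size s2.1 /\ aeq s1.1 s2.1 s1.2 s2.2.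

(* Main.v *)
Require Import Defs.
From mathcomp Require Import all_boot.
Set Implicit Arguments. Unset Strict Implicit. Unset Printing Implicit Defensive.

(* Both substitutes bind the same atoms: condition (3) of closedness says that
   an atom b with b # X not in Delta is moved identically by pi_i and pi_j unless
   it is abstracted at both occurrences, so pi_i(b) and pi_j(b) lie in Lambda_t(X)
   together.  The bodies translate pi_i . sigma(X) and pi_j . sigma(X), which are
   ground, hence contain no meta-variables; they differ only on free atoms of
   sigma(X) moved differently by pi_i and pi_j.  Such an atom b cannot satisfy
   b # X in Delta (sigma satisfies Delta), so by condition (3) it is a binder
   argument, and there the two bodies agree up to the renaming of the binders. *)

Section NestedInd.
Variables (P : nterm -> Prop) (Q : seq nterm -> Prop).
Hypotheses (HAtom : forall a, P (NAtom a)) (HSusp : forall p X, P (NSusp p X))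
  (HAbs : forall a s, P s -> P (NAbs a s)) (HApp : forall f s, P s -> P (NApp f s))
  (HTup : forall ts, Q ts -> P (NTup ts)) (Qnil : Q [::])
  (Qcons : forall u ts, P u -> Q ts -> Q (u :: ts)).

Fixpoint nterm_nested_ind (t : nterm) : P t :=
  match t with
  | NAtom a => HAtom a
  | NSusp p X => HSusp p X
  | NAbs a s => HAbs a (nterm_nested_ind s)
  | NApp f s => HApp f (nterm_nested_ind s)
  | NTup ts => HTup ((fix go (l : seq nterm) : Q l :=
       match l with [::] => Qnil | u :: l' => Qcons (nterm_nested_ind u) (go l') end) ts)
  end.
End NestedInd.

(* These list predicates are convertible with the recursions inlined in
   [ground], [fresh] and [aeq] on tuples, so they can serve as the list
   predicate of [nterm_nested_ind]. *)
Fixpoint all_ground (ts : seq nterm) : Prop :=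
  if ts is u :: ts' then ground u /\ all_ground ts' else True.

Definition all_fresh (D : fctx) (a : nat) : seq nterm -> Prop :=
  fix go (ts : seq nterm) : Prop :=
    if ts is u :: ts' then fresh D a u /\ go ts' else True.

Definition aeq_seq (l1 l2 : seq nat) : seq mterm -> seq mterm -> Prop :=
  fix go (ms ns : seq mterm) : Prop :=
    match ms, ns with
    | [::], [::] => True
    | m :: ms', n :: ns' => aeq l1 l2 m n /\ go ms' ns'
    | _, _ => False
    end.

Fixpoint free_atoms (t : nterm) : seq nat :=
  match t with
  | NAtom a => [:: a]
  | NSusp _ _ => [::]
  | NAbs a s => filter (predC1 a) (free_atoms s)
  | NApp _ s => free_atoms s
  | NTup ts => flatten (map free_atoms ts)
  end.

Lemma swap_atomK s : involutive (swap_atom s).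
Proof.
move=> c; rewrite /swap_atom.
case: (eqVneq c s.1) => [->|h1]; first by rewrite eqxx; case: eqVneq.
case: (eqVneq c s.2) => [->|h2]; first by rewrite eqxx.
by rewrite (negbTE h1) (negbTE h2).
Qed.

Lemma perm_atom_cat p q c : perm_atom (p ++ q) c = perm_atom p (perm_atom q c).
Proof. by elim: p => //= s p ->. Qed.

Lemma perm_atomK p : cancel (perm_atom p) (perm_atom (perm_inv p)).
Proof.
elim: p => //= s p IH c; rewrite /perm_inv rev_cons -cats1 perm_atom_cat /=.
by rewrite swap_atomK; apply: IH.
Qed.

Lemma perm_atomKV p : cancel (perm_atom (perm_inv p)) (perm_atom p).
Proof. by have := perm_atomK (perm_inv p); rewrite /perm_inv revK. Qed.

Lemma perm_atom_inj p : injective (perm_atom p).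
Proof. exact: can_inj (perm_atomK p). Qed.

Lemma nact0 s : nact [::] s = s.
Proof.
elim/(fun P => @nterm_nested_ind P (fun ts => map (nact [::]) ts = ts)): s => //=.
- by move=> a s ->.
- by move=> f s ->.
- by move=> ts ->.
- by move=> u ts -> ->.
Qed.

Lemma fresh_free_atomsF a s : fresh [::] a s -> a \notin free_atoms s.
Proof.
elim/(fun P => @nterm_nested_ind P (fun ts =>
  all_fresh [::] a ts -> a \notin flatten (map free_atoms ts))): s => //=.
- by move=> b /eqP; rewrite inE.
- by move=> b s IH [->|/IH h]; rewrite mem_filter /= ?eqxx // (negbTE h) andbF.
- by move=> u ts IHu IHts [/IHu h1 /IHts h2]; rewrite mem_cat negb_or h1 h2.
Qed.

Lemma ground_nact p s : ground (nact p s) -> ground s.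
Proof.
elim/(fun P => @nterm_nested_ind P (fun ts =>
  all_ground (map (nact p) ts) -> all_ground ts)): s => //=.
by move=> u ts IHu IHts [/IHu h1 /IHts h2].
Qed.

Lemma ground_napply_occ sigma t bs0 p X bs :
  (p, X, bs) \in occs_aux bs0 t -> ground (napply sigma t) ->
  ground (nact p (sigma_at sigma X)).
Proof.
elim/(fun P => @nterm_nested_ind P (fun ts => forall bs0,
  (p, X, bs) \in flatten (map (occs_aux bs0) ts) ->
  all_ground (map (napply sigma) ts) -> ground (nact p (sigma_at sigma X)))): t bs0
  => //=.
- by move=> q Y bs0; rewrite inE => /eqP[-> -> _].
- by move=> a s IH bs0 /IH.
- move=> u ts IHu IHts bs0; rewrite mem_cat => /orP[h [g _]|h [_ g]].
  + exact: IHu h g.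
  + exact: IHts h g.
Qed.

(* Atoms of [L] are bound, and [aeq] compares bound atoms only through the
   positions of their binders, which [map (perm_atom p_k) L] keeps in step. *)
Lemma aeq_trans_nact D w1 w2 p1 p2 s L :
  ground s ->
  {in free_atoms s, forall e, e \notin L -> perm_atom p1 e = perm_atom p2 e} ->
  aeq (map (perm_atom p1) L) (map (perm_atom p2) L)
      (trans_aux D w1 (nact p1 s)) (trans_aux D w2 (nact p2 s)).
Proof.
elim/(fun P => @nterm_nested_ind P (fun ts => forall L, all_ground ts ->
  {in flatten (map free_atoms ts), forall e, e \notin L ->
     perm_atom p1 e = perm_atom p2 e} ->
  aeq_seq (map (perm_atom p1) L) (map (perm_atom p2) L)
    (map (trans_aux D w1) (map (nact p1) ts))
    (map (trans_aux D w2) (map (nact p2) ts)))): s L => //=.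
- move=> a L _ agree; rewrite /atom_rel !(mem_map (@perm_atom_inj _)).
  case: (boolP (a \in L)) => aL /=.
  + by rewrite !index_map //; apply: perm_atom_inj.
  + by rewrite agree ?inE.
- move=> a s IH L g agree; apply: (IH (a :: L)) => // e es.
  by rewrite inE negb_or => /andP[ea eL]; apply: agree eL; rewrite mem_filter /= ea.
- by move=> f s IH L g agree; split => //; apply: IH.
- move=> u ts IHu IHts L [g1 g2] agree; split.
  + by apply: IHu => // e e1; apply: agree; rewrite mem_cat e1.
  + by apply: IHts => // e e1; apply: agree; rewrite mem_cat e1 orbT.
Qed.

Lemma mem_Lam t X p bs b : (p, X, bs) \in occs t -> b \in bs -> b \in Lam t X.
Proof.
move=> occ bb; apply/flattenP; exists bs => //.
by apply/mapP; exists (p, X, bs); rewrite ?mem_filter /= ?eqxx.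
Qed.

Lemma mem_asc_args D t X rho c :
  (c \in asc_args D t X rho) = ((c, X) \notin D) && (perm_atom rho c \in Lam t X).
Proof.
rewrite /asc_args mem_sort mem_undup mem_filter; congr (_ && _).
apply/mapP/idP => [[b bL ->]|cL]; first by rewrite perm_atomKV.
by exists (perm_atom rho c); rewrite ?perm_atomK.
Qed.

Lemma asc_args_eq_mem D t X p q :
  asc_args D t X p =i asc_args D t X q -> asc_args D t X p = asc_args D t X q.
Proof.
move=> eqpq; apply/perm_sortP; [exact: leq_total|exact: leq_trans|exact: anti_leq|].
by apply: uniq_perm; rewrite ?undup_uniq // => c; have := eqpq c; rewrite !mem_sort.
Qed.

Lemma closed_occ_perm_eq D t X pi_i pi_j bs_i bs_j b :
  nom_closed D t -> (pi_i, X, bs_i) \in occs t -> (pi_j, X, bs_j) \in occs t ->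
  (b, X) \notin D -> perm_atom pi_i b \notin bs_i ->
  perm_atom pi_i b = perm_atom pi_j b.
Proof.
case=> _ [_ cond3] occ_i occ_j bD notb; apply/eqP; apply/negPn/negP => /eqP ne.
by move: bD; rewrite (cond3 _ _ _ _ _ _ occ_i occ_j ne (or_introl notb)).
Qed.

Lemma mem_Lam_occ_perm D t X pi_i pi_j bs_i bs_j b :
  nom_closed D t -> (pi_i, X, bs_i) \in occs t -> (pi_j, X, bs_j) \in occs t ->
  (b, X) \notin D -> perm_atom pi_i b \in Lam t X -> perm_atom pi_j b \in Lam t X.
Proof.
move=> closed_t occ_i occ_j bD biL.
case: (boolP (perm_atom pi_j b \in bs_j)) => [bj|notbj]; first exact: mem_Lam occ_j bj.
by rewrite (closed_occ_perm_eq closed_t occ_j occ_i bD notbj).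
Qed.

Section TwoOccurrences.
Variables (D : fctx) (t : nterm) (X : nat) (pi_i pi_j : perm) (bs_i bs_j : seq nat).
Hypotheses (closed_t : nom_closed D t)
  (occ_i : (pi_i, X, bs_i) \in occs t) (occ_j : (pi_j, X, bs_j) \in occs t).

Lemma asc_args_occ_eq : asc_args D t X pi_i = asc_args D t X pi_j.
Proof.
apply: asc_args_eq_mem => c; rewrite !mem_asc_args.
case: (boolP ((c, X) \in D)) => //= cD; apply/idP/idP.
- exact: mem_Lam_occ_perm closed_t occ_i occ_j cD.
- exact: mem_Lam_occ_perm closed_t occ_j occ_i cD.
Qed.

Lemma occ_perm_eq_free_atoms sigma e :
  satisfies D sigma -> e \in free_atoms (sigma_at sigma X) ->
  e \notin asc_args D t X pi_i -> perm_atom pi_i e = perm_atom pi_j e.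
Proof.
move=> sat_sigma e_free; rewrite mem_asc_args.
case: (boolP ((e, X) \in D)) => /= [eD _|eD notL].
  by have := sat_sigma _ _ eD; rewrite /= nact0 => /fresh_free_atomsF; rewrite e_free.
apply: closed_occ_perm_eq closed_t occ_i occ_j eD _.
by apply: contraNN notL; apply: mem_Lam occ_i.
Qed.

End TwoOccurrences.

Theorem mainTheorem10 (D : fctx) (t : nterm) (sigma : nsubst) (X : nat)
    (pi_i pi_j : perm) (bs_i bs_j : seq nat) :
  nom_closed D t ->
  satisfies D sigma ->
  (forall Y, sigma Y <> None -> Y \in vars t) ->
  ground (napply sigma t) ->
  (pi_i, X, bs_i) \in occs t ->
  (pi_j, X, bs_j) \in occs t ->
  subst_aeq (subst_transl D t sigma X pi_i) (subst_transl D t sigma X pi_j).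
Proof.
move=> closed_t sat_sigma _ ground_t occ_i occ_j.
have ground_sX : ground (sigma_at sigma X).
  exact: ground_nact (ground_napply_occ occ_i ground_t).
rewrite /subst_transl /subst_aeq /= -(asc_args_occ_eq closed_t occ_i occ_j) !size_map.
split=> //; apply: aeq_trans_nact ground_sX _ => e e_free.
exact: (occ_perm_eq_free_atoms closed_t occ_i occ_j sat_sigma e_free).
Qed.
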